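(* Let $A$ be a curled algebra of dimension $2$ over $\mathbb F_2$. Then: (i) $A$ is zeropotent if and only if it is isomorphic to one of $ECC^2_0$ and $ECC^2_1$. (ii) $A$ is unital if and only if it is isomorphic to $ECC^2_6$. (iii) $A$ is commutative if and only if it is isomorphic to one of $ECC^2_0, ECC^2_1, ECC^2_6$ and $ECC^2_7$. (iv) $A$ is associative if and only if it is isomorphic to one of $ECC^2_0, ECC^2_4, ECC^2_5$ and $ECC^2_6$.
   Context: An algebra over the two-element field $\mathbb F_2$ is an $\mathbb F_2$-vector space with a bilinear multiplication, not assumed associative, commutative or unital; unital means having a two-sided identity element. A two-dimensional algebra is curled if, for every element $x$, the square $x^2$ is a scalar multiple of $x$. An algebra is zeropotent if $x^2=0$ for all its elements $x$. The following algebras over $\mathbb F_2$ are given on a linear base $\{e,f\}$ by their multiplication tables $\begin{pmatrix}e^2&ef\\ fe&f^2\end{pmatrix}$: $ECC^2_0:\begin{pmatrix}0&0\\ 0&0\end{pmatrix}$, $ECC^2_1:\begin{pmatrix}0&f\\ f&0\end{pmatrix}$, $ECC^2_4:\begin{pmatrix}e&f\\ 0&0\end{pmatrix}$, $ECC^2_5:\begin{pmatrix}e&0\\ f&0\end{pmatrix}$, $ECC^2_6:\begin{pmatrix}e&0\\ 0&f\end{pmatrix}$, $ECC^2_7:\begin{pmatrix}e&e+f\\ e+f&f\end{pmatrix}$. *)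

(* Defs.v *)
From HB Require Import structures.
From mathcomp Require Import all_boot all_order all_algebra.
From mathcomp Require Import ring.

Set Implicit Arguments.
Unset Strict Implicit.
Unset Printing Implicit Defensive.

Import GRing.Theory.
Local Open Scope ring_scope.

(* Finite-dimensional algebras that need not be associative, commutative or
   unital; MathComp's own algebra structures are all associative and unital. *)
Record naAlg (F : fieldType) := NaAlg {
  na_sort :> vectType F;
  na_mul : {bilinear na_sort -> na_sort -> na_sort}
}.

Definition amul (F : fieldType) (A : naAlg F) (x y : A) : A := na_mul A x y.
Arguments amul {F A} x y.

Definition adim (F : fieldType) (A : naAlg F) : nat := \dim (fullv : {vspace A}).

Definition curled (F : fieldType) (A : naAlg F) : Prop :=
  forall x : A, exists k : F, amul x x = k *: x.

Definition zeropotent (F : fieldType) (A : naAlg F) : Prop :=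
  forall x : A, amul x x = 0.

Definition unital (F : fieldType) (A : naAlg F) : Prop :=
  exists u : A, left_id u amul /\ right_id u amul.

Definition alg_commutative (F : fieldType) (A : naAlg F) : Prop :=
  commutative (amul : A -> A -> A).

Definition alg_associative (F : fieldType) (A : naAlg F) : Prop :=
  associative (amul : A -> A -> A).

Definition alg_iso (F : fieldType) (A B : naAlg F) : Prop :=
  exists f : {linear A -> B},
    bijective f /\ {morph f : x y / amul x y >-> amul x y}.

Section Table.

Variables (F : fieldType) (ee ef fe ff : 'rV[F]_2).

Definition table_mul (x y : 'rV[F]_2) : 'rV[F]_2 :=
  (x 0 0 * y 0 0) *: ee + (x 0 0 * y 0 1) *: ef +
  (x 0 1 * y 0 0) *: fe + (x 0 1 * y 0 1) *: ff.

Lemma table_mul_is_bilinear : bilinear_for *:%R *:%R table_mul.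
Proof.
by split=> z a x y; apply/rowP=> j; rewrite /table_mul !mxE; ring.
Qed.

HB.instance Definition _ :=
  bilinear_isBilinear.Build F 'rV[F]_2 'rV[F]_2 'rV[F]_2 *:%R *:%R
    table_mul table_mul_is_bilinear.

Definition table_alg : naAlg F :=
  @NaAlg F 'rV[F]_2 (table_mul : {bilinear _ -> _ -> _}).

End Table.

Definition vec_e : 'rV['F_2]_2 := delta_mx 0 0.
Definition vec_f : 'rV['F_2]_2 := delta_mx 0 1.

(* The arguments of [table_alg] are e^2, ef, fe, f^2, in this order. *)
Definition ECC0 : naAlg 'F_2 := table_alg 0 0 0 0.
Definition ECC1 : naAlg 'F_2 := table_alg 0 vec_f vec_f 0.
Definition ECC4 : naAlg 'F_2 := table_alg vec_e vec_f 0 0.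
Definition ECC5 : naAlg 'F_2 := table_alg vec_e 0 vec_f 0.
Definition ECC6 : naAlg 'F_2 := table_alg vec_e 0 0 vec_f.
Definition ECC7 : naAlg 'F_2 :=
  table_alg vec_e (vec_e + vec_f) (vec_e + vec_f) vec_f.

(* Main.v *)
Require Import Defs.
From HB Require Import structures.
From mathcomp Require Import all_boot all_order all_algebra.
From mathcomp Require Import ring.

(** Every nonzero [x] of a curled algebra over F_2 is idempotent or of square
    zero, and any two distinct nonzero vectors of an F_2-plane form a base, so
    an algebra is identified as soon as two such vectors with the right four
    products are found ([iso_table_alg]).  The four properties pass along
    isomorphisms and hold in the listed tables, so only the search for good
    bases is left.

    Zeropotent: if some product [e f] is nonzero, it is itself a good second
    base vector, because [x y] is then alternating and hence equal to the
    determinant of [x] and [y] times [e f].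

    Unital: for [x] other than 0 and the unit 1, the square of [1 + x] is
    [1 + x^2], which is a multiple of [1 + x] only if [x^2 = x]; then [x] and
    [1 + x] are orthogonal idempotents.

    Commutative: the square is additive, so that [x^2 = k_x x] makes [k]
    constant on nonzero vectors; either the algebra is zeropotent, or all its
    elements are idempotent.  In the second case, either two independent
    elements have product 0, which gives [ECC6], or every product of two
    independent elements is their sum, which gives [ECC7].

    Associative: the only associative zeropotent algebra is the zero one.
    Otherwise there is an idempotent [e], whose left and right multiplications
    are commuting projections; their Peirce decomposition gives a second base
    vector [f] with [e f] and [f e] in [{0, f}] ([peirce_vector]), and each of
    the four possibilities determines [f^2]. *)

Set Implicit Arguments.
Unset Strict Implicit.
Unset Printing Implicit Defensive.

Import GRing.Theory.
Local Open Scope ring_scope.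

(** * Algebras over an arbitrary field *)

Section Field.

Variable F : fieldType.
Implicit Types A B : naAlg F.

Lemma amulDl A (x y z : A) : amul (x + y) z = amul x z + amul y z.
Proof. exact: linearDl. Qed.

Lemma amulDr A (x y z : A) : amul x (y + z) = amul x y + amul x z.
Proof. exact: linearDr. Qed.

Lemma amulZl A k (x y : A) : amul (k *: x) y = k *: amul x y.
Proof. exact: linearZl_LR. Qed.

Lemma amulZr A k (x y : A) : amul x (k *: y) = k *: amul x y.
Proof. exact: linearZr_LR. Qed.

Lemma amul0l A (x : A) : amul 0 x = 0.
Proof. exact: linear0l. Qed.

Lemma amul0r A (x : A) : amul x 0 = 0.
Proof. exact: linear0r. Qed.

Lemma zeropotent_iso A B : alg_iso A B -> zeropotent B -> zeropotent A.
Proof.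
by case=> f [/bij_inj injf fM] zB x; apply: injf; rewrite fM zB linear0.
Qed.

Lemma commutative_iso A B :
  alg_iso A B -> alg_commutative B -> alg_commutative A.
Proof. by case=> f [/bij_inj injf fM] cB x y; apply: injf; rewrite !fM cB. Qed.

Lemma associative_iso A B :
  alg_iso A B -> alg_associative B -> alg_associative A.
Proof.
by case=> f [/bij_inj injf fM] aB x y z; apply: injf; rewrite !fM aB.
Qed.

Lemma unital_iso A B : alg_iso A B -> unital B -> unital A.
Proof.
case=> f [[g fK gK] fM] [u [ul ur]]; exists (g u); split=> x;
  by apply: (can_inj fK); rewrite fM gK ?ul ?ur.
Qed.

Lemma row2P (x y : 'rV[F]_2) : x 0 0 = y 0 0 -> x 0 1 = y 0 1 -> x = y.
Proof.
move=> xy0 xy1; apply/rowP=> j.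
by have /orP[/eqP->|/eqP->] : (j == 0) || (j == 1) by case: j => [[|[|]]].
Qed.

Definition comb (V : lmodType F) (e f : V) (x : 'rV[F]_2) : V :=
  x 0 0 *: e + x 0 1 *: f.

Lemma combD (V : lmodType F) (e f : V) x y :
  comb e f (x + y) = comb e f x + comb e f y.
Proof. by rewrite /comb !mxE !scalerDl addrACA. Qed.

Lemma combZ (V : lmodType F) (e f : V) k x :
  comb e f (k *: x) = k *: comb e f x.
Proof. by rewrite /comb !mxE scalerDr !scalerA. Qed.

(** The isomorphism is the coordinate map of the base. *)
Lemma iso_table_alg A (e f : A) (ee ef fe ff : 'rV[F]_2) :
    basis_of fullv [tuple e; f] ->
    amul e e = comb e f ee -> amul e f = comb e f ef ->
    amul f e = comb e f fe -> amul f f = comb e f ff ->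
  alg_iso A (table_alg ee ef fe ff).
Proof.
move=> bef mee mef mfe mff.
have freeX := basis_free bef.
pose phi (v : A) : table_alg ee ef fe ff :=
  \row_i coord [tuple e; f] i v.
have phi_lin : linear phi by move=> k u v; apply/rowP=> i; rewrite !mxE linearP.
pose phiL := GRing.isLinear.Build F A (table_alg ee ef fe ff) *:%R phi phi_lin.
pose Phi : {linear A -> table_alg ee ef fe ff} := HB.pack phi phiL.
have phiK : cancel phi (comb e f).
  move=> v; rewrite /comb !mxE [RHS](coord_basis bef (memvf v)).
  rewrite !big_ord_recl big_ord0 addr0 /=.
  by congr (coord _ _ _ *: _ + coord _ _ _ *: _); apply: val_inj.
have combK : cancel (comb e f) phi.
  have combE x : comb e f x = \sum_(i < 2) x 0 i *: [tuple e; f]`_i.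
    rewrite !big_ord_recl big_ord0 addr0 /comb /=.
    by congr (x 0 _ *: _ + x 0 _ *: _); apply: val_inj.
  by move=> x; apply/rowP=> i; rewrite combE mxE coord_sum_free.
exists Phi; split=> [|u v]; first by exists (comb e f).
apply: (can_inj combK); rewrite [comb e f (Phi _)]phiK.
rewrite -{1}[u]phiK -{1}[v]phiK [amul (Phi _) _]/(table_mul _ _ _ _ _ _).
rewrite /table_mul !(combD, combZ) -mee -mef -mfe -mff {1 2}/comb.
by rewrite !(amulDl, amulDr, amulZl, amulZr) !scalerA !addrA.
Qed.

End Field.

(** * The tables *)

(** Apart from the zeropotence of [ECC1], which needs characteristic 2, the
    properties of the tables are polynomial identities in the coordinates, valid
    over every field. *)
Section Tables.

Variable F : fieldType.

Let e : 'rV[F]_2 := delta_mx 0 0.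
Let f : 'rV[F]_2 := delta_mx 0 1.

Ltac table_calc :=
  apply: row2P; rewrite /amul /= /table_mul !mxE /=; ring.

Lemma table_zero_zeropotent : zeropotent (@table_alg F 0 0 0 0).
Proof. by move=> x; table_calc. Qed.

Lemma table_zero_associative : alg_associative (@table_alg F 0 0 0 0).
Proof. by move=> x y z; table_calc. Qed.

Lemma table_commutative (ee ef ff : 'rV[F]_2) :
  alg_commutative (table_alg ee ef ef ff).
Proof. by move=> x y; table_calc. Qed.

Lemma table_left_associative : alg_associative (table_alg e f 0 0).
Proof. by move=> x y z; table_calc. Qed.

Lemma table_right_associative : alg_associative (table_alg e 0 f 0).
Proof. by move=> x y z; table_calc. Qed.

Lemma table_split_associative : alg_associative (table_alg e 0 0 f).
Proof. by move=> x y z; table_calc. Qed.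

Lemma table_split_unital : unital (table_alg e 0 0 f).
Proof. by exists (e + f); split=> x; table_calc. Qed.

End Tables.

Lemma F2_scalar (k : 'F_2) : k = 0 \/ k = 1.
Proof. by case: k => [[|[|?]] ?] //; [left | right]; apply: val_inj. Qed.

Lemma F2_addvv (V : lmodType 'F_2) (x : V) : x + x = 0.
Proof.
rewrite -mulr2n -scaler_nat (_ : 2%:R = 0) ?scale0r //; exact: val_inj.
Qed.

Lemma F2_addKv (V : lmodType 'F_2) (x y : V) : x + (x + y) = y.
Proof. by rewrite addrA F2_addvv add0r. Qed.

Lemma F2_addvK (V : lmodType 'F_2) (x y : V) : y + x + x = y.
Proof. by rewrite -addrA F2_addvv addr0. Qed.

Lemma F2_addv_eq0 (V : lmodType 'F_2) (x y : V) : (x + y == 0) = (x == y).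
Proof.
apply/eqP/eqP=> [xy0 | ->]; last exact: F2_addvv.
by rewrite -[RHS](F2_addKv x) xy0 addr0.
Qed.

Lemma eq_addl (V : zmodType) (x y : V) : (y == x + y) = (x == 0).
Proof. by rewrite -[LHS]subr_eq0 opprD addrCA subrr addr0 oppr_eq0. Qed.

Lemma zeropotent_ECC1 : zeropotent ECC1.
Proof.
move=> x; rewrite /amul /= /table_mul !scaler0 add0r addr0 (mulrC (x 0 1)).
exact: F2_addvv.
Qed.

(** * Bases of an F_2-plane *)

(** Over F_2 the only scalars are 0 and 1, so these three inequalities say that
    [e] and [f] are linearly independent. *)
Definition frame (V : lmodType 'F_2) (e f : V) :=
  [&& e != 0, f != 0 & e != f].

Lemma frame_swap (V : lmodType 'F_2) (e f : V) : frame e f -> frame f e.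
Proof. by case/and3P=> e0 f0 ef; apply/and3P; split; rewrite // eq_sym. Qed.

Lemma frame_shear (V : lmodType 'F_2) (e f : V) : frame e f -> frame e (e + f).
Proof.
case/and3P=> e0 f0 ef; apply/and3P; split; rewrite ?F2_addv_eq0 //.
by rewrite -F2_addv_eq0 F2_addKv.
Qed.

Section Plane.

Variables (A : naAlg 'F_2) (dimA : adim A = 2%N).
Implicit Types x y e f : A.

Lemma frame_basis e f : frame e f -> basis_of fullv [tuple e; f].
Proof.
case/and3P=> e0 f0 ef; rewrite basisEfree subvf [\dim _]dimA !andbT.
rewrite free_cons seq1_free f0 span_seq1 andbT.
apply: contra ef => /vlineP[k ke]; move: e0; rewrite {}ke.
by have [->|->] := F2_scalar k; rewrite ?scale0r ?scale1r ?eqxx.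
Qed.

Lemma frame_elements e f x :
  frame e f -> [\/ x = 0, x = e, x = f | x = e + f].
Proof.
move/frame_basis=> bef; rewrite [x](coord_basis bef (memvf x)).
rewrite !big_ord_recl big_ord0 addr0 /=.
set a := coord _ _ _; set b := coord _ _ _.
have [->|->] := F2_scalar a; have [->|->] := F2_scalar b;
  rewrite ?scale0r ?scale1r ?addr0 ?add0r; by constructor.
Qed.

Lemma nonzero_frame e : e != 0 -> exists f, frame e f.
Proof.
move=> e0.
have /subvPn[f _ ef] : ~~ (fullv <= <[e]>)%VS.
  apply/negP=> /dimvS; rewrite [\dim fullv]dimA dim_vline; by case: (_ == _).
exists f; rewrite /frame e0 /=; apply/andP; split.
  by apply: contraNneq ef => ->; rewrite mem0v.
by apply: contraNneq ef => <-; rewrite memv_line.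
Qed.

Lemma frame_exists : exists e f, frame e f.
Proof.
suff [e /nonzero_frame[f ef]] : exists e, e != 0 by exists e, f.
exists (vpick fullv); rewrite vpick0; apply/eqP=> A0.
by move: dimA; rewrite /adim A0 dimv0.
Qed.

Section Recognition.

Variables (e f : A) (ef_frame : frame e f).

Ltac comb_calc :=
  by rewrite /comb /vec_e /vec_f !mxE ?eqxx /= ?scale0r ?scale1r ?addr0 ?add0r.

Lemma comb0 : comb e f 0 = 0.
Proof. comb_calc. Qed.

Lemma comb_e : comb e f vec_e = e.
Proof. comb_calc. Qed.

Lemma comb_f : comb e f vec_f = f.
Proof. comb_calc. Qed.

Lemma iso_ECC0 :
  amul e e = 0 -> amul e f = 0 -> amul f e = 0 -> amul f f = 0 ->
  alg_iso A ECC0.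
Proof.
by move=> *; apply: (iso_table_alg (frame_basis ef_frame)); rewrite comb0.
Qed.

Lemma iso_ECC1 :
  amul e e = 0 -> amul e f = f -> amul f e = f -> amul f f = 0 ->
  alg_iso A ECC1.
Proof.
by move=> *; apply: (iso_table_alg (frame_basis ef_frame));
  rewrite ?comb0 ?comb_f.
Qed.

Lemma iso_ECC4 :
  amul e e = e -> amul e f = f -> amul f e = 0 -> amul f f = 0 ->
  alg_iso A ECC4.
Proof.
by move=> *; apply: (iso_table_alg (frame_basis ef_frame));
  rewrite ?comb0 ?comb_e ?comb_f.
Qed.

Lemma iso_ECC5 :
  amul e e = e -> amul e f = 0 -> amul f e = f -> amul f f = 0 ->
  alg_iso A ECC5.
Proof.
by move=> *; apply: (iso_table_alg (frame_basis ef_frame));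
  rewrite ?comb0 ?comb_e ?comb_f.
Qed.

Lemma iso_ECC6 :
  amul e e = e -> amul e f = 0 -> amul f e = 0 -> amul f f = f ->
  alg_iso A ECC6.
Proof.
by move=> *; apply: (iso_table_alg (frame_basis ef_frame));
  rewrite ?comb0 ?comb_e ?comb_f.
Qed.

Lemma iso_ECC7 :
  amul e e = e -> amul e f = e + f -> amul f e = e + f -> amul f f = f ->
  alg_iso A ECC7.
Proof.
by move=> *; apply: (iso_table_alg (frame_basis ef_frame));
  rewrite ?combD ?comb_e ?comb_f.
Qed.

End Recognition.

(** * Classification of the curled algebras with each property *)

Hypothesis curledA : curled A.

Lemma curled_square x : amul x x = 0 \/ amul x x = x.
Proof.
have [k ->] := curledA x.
by have [->|->] := F2_scalar k; rewrite ?scale0r ?scale1r; [left | right].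
Qed.

Lemma zeropotent_amulC : zeropotent A -> alg_commutative A.
Proof.
move=> zA x y; apply/eqP; rewrite -F2_addv_eq0.
by have:= zA (x + y); rewrite amulDl !amulDr !zA add0r addr0 => ->.
Qed.

(** Each nonzero value of [e f] is the second vector [y] of a base [x, y] with
    [x y = y]. *)
Lemma zeropotent_classification :
  zeropotent A -> alg_iso A ECC0 \/ alg_iso A ECC1.
Proof.
move=> zA; have cA := zeropotent_amulC zA.
have [e [f ef]] := frame_exists.
have right_eigen x y : frame x y -> amul x y = y -> alg_iso A ECC1.
  by move=> xy xyE; apply: (iso_ECC1 xy); rewrite ?zA // cA.
have [efE|efE|efE|efE] := frame_elements (amul e f) ef.
- by left; apply: (iso_ECC0 ef); rewrite ?zA // cA.
- by right; apply: (right_eigen f e); [exact: frame_swap | rewrite cA].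
- by right; apply: (right_eigen e f).
right; apply: (right_eigen e (e + f)); first exact: frame_shear.
by rewrite amulDr zA add0r.
Qed.

(** A curled unital algebra is spanned by an idempotent and its complement. *)
Lemma unital_classification : unital A -> alg_iso A ECC6.
Proof.
case=> u [ul ur].
have u0 : u != 0.
  have [e [f /and3P[e0 _ _]]] := frame_exists.
  by apply: contraNneq e0 => u0; rewrite -(ul e) u0 amul0l.
have [f uf] := nonzero_frame u0.
have [_ f0 /negPf ufN] := and3P uf.
have uf2 : amul (u + f) (u + f) = u + amul f f.
  by rewrite amulDl !amulDr !ul ur addrA F2_addvK.
have ff : amul f f = f.
  have [ff0|//] := curled_square f; move: uf2; rewrite ff0 addr0.
  have [->/esym/eqP|->] := curled_square (u + f); first by rewrite (negPf u0).
  move/(congr1 (+%R u)); rewrite F2_addKv F2_addvv => /eqP.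
  by rewrite (negPf f0).
have fuf : frame f (u + f) by rewrite addrC; apply/frame_shear/frame_swap.
by apply: (iso_ECC6 fuf);
  rewrite // ?amulDr ?amulDl ?ul ?ur ?ff ?F2_addvv // addr0.
Qed.

(** Squaring is additive here.  If [x^2 = x] and [y^2 = 0] for independent
    [x, y], then the square of [x + y] is [x], which is no multiple of [x + y];
    so either all elements have square zero or all are idempotent. *)
Lemma commutative_classification :
  alg_commutative A ->
  alg_iso A ECC0 \/ alg_iso A ECC1 \/ alg_iso A ECC6 \/ alg_iso A ECC7.
Proof.
move=> cA.
have sqD x y : amul (x + y) (x + y) = amul x x + amul y y.
  by rewrite amulDl !amulDr (cA y x) addrA F2_addvK.
have mixed x y : frame x y -> amul x x = x -> amul y y = y.
  case/and3P=> x0 y0 xy xx; have [yy|//] := curled_square y.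
  move: (sqD x y); rewrite xx yy addr0.
  have [->/esym/eqP|->] := curled_square (x + y); first by rewrite (negPf x0).
  move/(congr1 (+%R x)); rewrite F2_addKv F2_addvv => /eqP.
  by rewrite (negPf y0).
have [e [f ef]] := frame_exists.
have [ee|ee] := curled_square e.
  have ff : amul f f = 0.
    have [//|ff] := curled_square f.
    have := mixed _ _ (frame_swap ef) ff; rewrite ee => /eqP.
    by rewrite eq_sym; case/and3P: ef => /negPf->.
  have zA : zeropotent A.
    move=> x; have [->|->|->|->] := frame_elements x ef; rewrite ?amul0l //.
    by rewrite sqD ee ff addr0.
  by have [|] := zeropotent_classification zA; [left | right; left].
have ff := mixed _ _ ef ee.
do 2 right.
have orthogonal x y :
    frame x y -> amul x x = x -> amul y y = y -> amul x y = 0 ->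
    alg_iso A ECC6.
  by move=> xy xx yy xy0; apply: (iso_ECC6 xy); rewrite // cA.
have [efE|efE|efE|efE] := frame_elements (amul e f) ef.
- by left; apply: (orthogonal e f).
- left; apply: (orthogonal e (e + f)); rewrite ?sqD ?ee ?ff //.
    exact: frame_shear.
  by rewrite amulDr ee efE F2_addvv.
- left; apply: (orthogonal f (f + e)); rewrite ?sqD ?ee ?ff //.
    exact/frame_shear/frame_swap.
  by rewrite amulDr ff cA efE F2_addvv.
by right; apply: (iso_ECC7 ef); rewrite // cA.
Qed.

(** Adding the idempotent [e] to [g] adds [e] to [e g] and to [g e], so one of
    [g] and [e + g] has its products with [e] free of an [e]-component. *)
Lemma peirce_vector e :
    alg_associative A -> e != 0 -> amul e e = e ->
  exists f, [/\ frame e f, amul e f = 0 \/ amul e f = f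
                & amul f e = 0 \/ amul f e = f].
Proof.
move=> aA e0 ee.
have [g [eg_frame egE]] :
    exists g, frame e g /\ (amul e g = 0 \/ amul e g = g).
  have [g eg_frame] := nonzero_frame e0.
  have [egE|egE|egE|egE] := frame_elements (amul e g) eg_frame.
  - by exists g; split=> //; left.
  - exists (e + g); split; first exact: frame_shear.
    by left; rewrite amulDr ee egE F2_addvv.
  - by exists g; split=> //; right.
  have /eqP := aA e e g.
  by rewrite ee egE amulDr ee egE F2_addKv eq_addl (negPf e0).
have [geE|geE|geE|geE] := frame_elements (amul g e) eg_frame.
- by exists g; split=> //; left.
- have [eg0|egg] := egE.
    by have /eqP := aA e g e; rewrite geE eg0 ee amul0l (negPf e0).
  exists (e + g); split; first exact: frame_shear.
    by right; rewrite amulDr ee egg.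
  by left; rewrite amulDl ee geE F2_addvv.
- by exists g; split=> //; right.
have /eqP := aA g e e.
by rewrite ee geE amulDl ee geE F2_addKv eq_sym eq_addl (negPf e0).
Qed.

Lemma zeropotent_or_idempotent :
  zeropotent A \/ exists e, e != 0 /\ amul e e = e.
Proof.
have [e [f ef]] := frame_exists; have /and3P[e0 f0 efN] := ef.
have [ee|ee] := curled_square e; last by right; exists e.
have [ff|ff] := curled_square f; last by right; exists f.
have [gg|gg] := curled_square (e + f).
  by left=> x; have [->|->|->|->] := frame_elements x ef; rewrite ?amul0l.
by right; exists (e + f); rewrite F2_addv_eq0.
Qed.

(** Both [e (e f)] and [(e f) f] vanish, which excludes every nonzero value of
    [e f]. *)
Lemma associative_zeropotent_iso :
  alg_associative A -> zeropotent A -> alg_iso A ECC0.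
Proof.
move=> aA zA; have [e [f ef]] := frame_exists.
have e_ef : amul e (amul e f) = 0 by rewrite aA zA amul0l.
have ef_f : amul (amul e f) f = 0 by rewrite -aA zA amul0r.
have ef0 : amul e f = 0.
  have [//|efE|efE|efE] := frame_elements (amul e f) ef.
  - by move: ef_f; rewrite {1}efE.
  - by move: e_ef; rewrite {1}efE.
  by move: e_ef; rewrite {1}efE amulDr zA add0r.
by apply: (iso_ECC0 ef); rewrite ?zA // zeropotent_amulC.
Qed.

Lemma associative_classification :
  alg_associative A ->
  alg_iso A ECC0 \/ alg_iso A ECC4 \/ alg_iso A ECC5 \/ alg_iso A ECC6.
Proof.
move=> aA.
have [zA|[e [e0 ee]]] := zeropotent_or_idempotent.
  by left; apply: associative_zeropotent_iso.
have [f [ef efE feE]] := peirce_vector aA e0 ee.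
(* When exactly one of [e f], [f e] is zero, this identity reads [f^2 = 0]. *)
have f_ef : amul f (amul e f) = amul (amul f e) f := aA f e f.
case: efE feE f_ef => efE [] feE; rewrite efE feE ?amul0l ?amul0r => ff.
- have [ff0|ff1] := curled_square f; last by do 3 right; apply: (iso_ECC6 ef).
  (* With [f^2 = 0] the square of [e + f] would be [e]. *)
  have := curled_square (e + f).
  rewrite amulDl !amulDr ee efE feE ff0 !addr0.
  case=> /eqP; first by rewrite (negPf e0).
  by rewrite addrC eq_addl; case/and3P: ef => _ /negPf->.
- by do 2 right; left; apply: (iso_ECC5 ef).
- by right; left; apply: (iso_ECC4 ef).
do 3 right; apply: unital_classification.
by exists e; split=> x; have [->|->|->|->] := frame_elements x ef;
  rewrite ?amul0l ?amul0r ?amulDl ?amulDr ?ee ?efE ?feE.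
Qed.

End Plane.

Theorem proposition5 (A : naAlg 'F_2) (dimA : adim A = 2%N) (curledA : curled A) :
  (zeropotent A <-> alg_iso A ECC0 \/ alg_iso A ECC1) /\
  (unital A <-> alg_iso A ECC6) /\
  (alg_commutative A <->
     alg_iso A ECC0 \/ alg_iso A ECC1 \/ alg_iso A ECC6 \/ alg_iso A ECC7) /\
  (alg_associative A <->
     alg_iso A ECC0 \/ alg_iso A ECC4 \/ alg_iso A ECC5 \/ alg_iso A ECC6).
Proof.
split; [|split; [|split]]; split.
- exact: zeropotent_classification.
- case=> /zeropotent_iso; apply; [exact: table_zero_zeropotent|].
  exact: zeropotent_ECC1.
- exact: unital_classification.
- by move/unital_iso; apply; apply: table_split_unital.
- exact: commutative_classification.
- by case=> [|[|[|]]] /commutative_iso; apply; apply: table_commutative.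
- exact: associative_classification.
case=> [|[|[|]]] /associative_iso; apply.
- exact: table_zero_associative.
- exact: table_left_associative.
- exact: table_right_associative.
exact: table_split_associative.
Qed.
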